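(* Let $0<T_1\le T_2$ and $n\ge2$. If there exist a scalar $\mu>0$ and symmetric positive definite matrices $P_2\in\mathbb R^{2\times2}$, $P_3\in\mathbb R^{2(n-1)\times2(n-1)}$ such that $$P_2A_{f_3}+A_{f_3}^\top P_2\prec0,\qquad P_3A_{f_4}+A_{f_4}^\top P_3\prec0,$$ then the hybrid system $\widetilde{\mathcal H}_{mr}$ with input $\bar m_{\tau^*}$ is input-to-state stable with respect to $\widetilde{\mathcal A}_{\varepsilon_r}=\{0\}\times\{0\}\times[0,T_2]$.
   Context: Matrices, with $I=I_{n-1}$: $A_{f_3}=\begin{bmatrix}0&\mu\\-1&-1\end{bmatrix}$, $A_{f_4}=\begin{bmatrix}0&\mu I\\-I&-I\end{bmatrix}$, $B_{m_1}=\begin{bmatrix}\mu&0\\0&1\end{bmatrix}$, $B_{m_2}=\begin{bmatrix}\mu I&0\\0&I\end{bmatrix}$. System $\widetilde{\mathcal H}_{mr}$. State $\chi=(\bar w_1,\bar w_2,\tau)\in\mathbb R^2\times\mathbb R^{2(n-1)}\times[0,T_2]$. The input is $\bar m_{\tau^*}=(\bar m_{\tau_1^*},\dots,\bar m_{\tau_n^*})\in\mathbb R^n$ (a noise on the internal clock outputs in transformed coordinates); put $\bar q_1=(\bar m_{\tau^*_1},\bar m_{\tau^*_1})$ and $\bar q_2=(\bar m_{\tau^*_2},\dots,\bar m_{\tau^*_n},\bar m_{\tau^*_2},\dots,\bar m_{\tau^*_n})$. On the flow set (the whole state space), $\dot\chi=(A_{f_3}\bar w_1+B_{m_1}\bar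 q_1,\ A_{f_4}\bar w_2+B_{m_2}\bar q_2,\ -1)$. On the jump set $\{\tau=0\}$, $\chi^+\in(\bar w_1,\bar w_2,[T_1,T_2])$. Solutions and ISS. Solutions are defined on hybrid time domains $E\subset\mathbb R_{\ge0}\times\mathbb N$ (for each $(T,J)\in E$, $E\cap([0,T]\times\{0,\dots,J\})=\bigcup_{j=0}^J[t_j,t_{j+1}]\times\{j\}$ with $0=t_0\le\dots\le t_{J+1}$), are locally absolutely continuous in $t$ for each $j$, satisfy the differential equation in the flow set on flow intervals and the inclusion in the jump set at jumps; a solution pair $(\phi,m)$ consists of a state trajectory and an input on the same domain; $|m|_\infty$ is the sup norm of the input. $|x|_\Sigma=\inf_{y\in\Sigma}|x-y|$. The system is input-to-state stable with respect to a set $\mathcal A$ if there are $\beta\in\mathcal{KL}$, $\kappa\in\mathcal K$ such that every solution pair satisfies $|\phi(t,j)|_{\mathcal A}\le\max\{\beta(|\phi(0,0)|_{\mathcal A},t+j),\kappa(|m|_\infty)\}$ for all $(t,j)\in\mathrm{dom}\,\phi$. *)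

(* Defs.v *)
From HB Require Import structures.
From mathcomp Require Import all_boot all_order all_algebra.
From mathcomp Require Import all_classical all_reals all_analysis.

Set Implicit Arguments.
Unset Strict Implicit.
Unset Printing Implicit Defensive.

Import Order.TTheory GRing.Theory Num.Theory.
Import numFieldNormedType.Exports.

Local Open Scope classical_set_scope.
Local Open Scope ring_scope.

Definition posdefmx (R : realType) (k : nat) (P : 'M[R]_k) : Prop :=
  P^T = P /\ forall x : 'cV[R]_k, x != 0 -> 0 < (x^T *m P *m x) 0 0.

Definition negdefmx (R : realType) (k : nat) (P : 'M[R]_k) : Prop :=
  posdefmx (- P).

(* The library norm on matrices is the max norm, hence this definition. *)
Definition eucl (R : realType) (k : nat) (x : 'cV[R]_k) : R :=
  Num.sqrt (\sum_(i < k) x i 0 ^+ 2).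

Definition dist_to (R : realType) (k : nat) (S : set 'cV[R]_k)
    (x : 'cV[R]_k) : R :=
  inf [set eucl (x - y) | y in S].

(* Comparison functions live on [0, +oo[; their values elsewhere are
   irrelevant. *)
Definition class_K (R : realType) (kappa : R -> R) : Prop :=
  [/\ {within `[0, +oo[, continuous kappa},
      forall x y, 0 <= x -> x < y -> kappa x < kappa y
    & kappa 0 = 0].

Definition class_KL (R : realType) (beta : R -> R -> R) : Prop :=
  [/\ {within [set p : R * R | 0 <= p.1 /\ 0 <= p.2],
        continuous (fun p : R * R => beta p.1 p.2)},
      forall s, 0 <= s -> class_K (beta ^~ s),
      forall r s s', 0 <= r -> 0 <= s -> s <= s' -> beta r s' <= beta r s
    & forall r, 0 <= r -> beta r s @[s --> +oo] --> 0].

(* The list [s] is a finite family of nonoverlapping subintervals of [a, b],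
   each given by its pair of endpoints. *)
Definition abs_continuous (R : realType) (f : R -> R) (a b : R) : Prop :=
  forall e : R, 0 < e -> exists2 d : R, 0 < d &
    forall s : seq (R * R),
      all (fun p => [&& a <= p.1, p.1 <= p.2 & p.2 <= b]) s ->
      pairwise (fun p q => (p.2 <= q.1) || (q.2 <= p.1)) s ->
      \sum_(p <- s) (p.2 - p.1) < d ->
      \sum_(p <- s) `|f p.2 - f p.1| < e.

Definition hybrid_time_domain (R : realType) (E : set (R * nat)) : Prop :=
  (forall p, E p -> 0 <= p.1) /\
  forall T J, E (T, J) -> exists t : nat -> R,
    [/\ t 0%N = 0,
        forall j, (j <= J)%N -> t j <= t j.+1
      & E `&` [set p | 0 <= p.1 <= T /\ (p.2 <= J)%N] =
        [set p | (p.2 <= J)%N /\ t p.2 <= p.1 <= t p.2.+1]].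

Definition time_slice (R : realType) (E : set (R * nat)) (j : nat) : set R :=
  [set t | E (t, j)].

(* Hybrid system with state in a subset of R^d and input in R^p,
     x' = f(x, u) if x in C,    x^+ in G(x, u) if x in D. *)
Record hybrid_system (R : realType) (d p : nat) := HybridSystem {
  state_space : set 'cV[R]_d ;
  flow_set : set 'cV[R]_d ;
  flow_map : 'cV[R]_d -> 'cV[R]_p -> 'cV[R]_d ;
  jump_set : set 'cV[R]_d ;
  jump_map : 'cV[R]_d -> 'cV[R]_p -> set 'cV[R]_d }.

(* [phi] and [m] are total functions of which only the values on the common
   domain [E] matter. In particular the derivative is required at interior
   points of the slices only; the endpoints form a null set. *)
Definition solution_pair (R : realType) (d p : nat) (H : hybrid_system R d p)
    (E : set (R * nat)) (phi : R -> nat -> 'cV[R]_d)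
    (m : R -> nat -> 'cV[R]_p) : Prop :=
  [/\ hybrid_time_domain E,
      forall t j, E (t, j) -> state_space H (phi t j),
      forall j a b, `[a, b] `<=` time_slice E j ->
        forall i, abs_continuous (fun t => phi t j i 0) a b,
      forall j,
        (forall t, interior (time_slice E j) t -> flow_set H (phi t j)) /\
        {ae (@lebesgue_measure R), forall t : R,
          interior (time_slice E j) t ->
          forall i, is_derive t (1 : R) (fun s : R => phi s j i 0)
                      (flow_map H (phi t j) (m t j) i 0)}
    & forall t j, E (t, j) -> E (t, j.+1) ->
        jump_set H (phi t j) /\ jump_map H (phi t j) (m t j) (phi t j.+1)].

Definition input_norm (R : realType) (p : nat) (E : set (R * nat))
    (m : R -> nat -> 'cV[R]_p) : \bar R :=
  ereal_sup [set (eucl (m z.1 z.2))%:E | z in E].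

(* The bound carries no information when the input is unbounded, as kappa
   is only defined on [0, +oo[. *)
Definition input_to_state_stable (R : realType) (d p : nat)
    (H : hybrid_system R d p) (A : set 'cV[R]_d) : Prop :=
  exists (beta : R -> R -> R) (kappa : R -> R),
    [/\ class_KL beta, class_K kappa
      & forall E phi m, solution_pair H E phi m ->
          (input_norm E m < +oo)%E ->
          forall t j, E (t, j) ->
            dist_to A (phi t j) <=
              Num.max (beta (dist_to A (phi 0 0%N)) (t + j%:R))
                      (kappa (fine (input_norm E m)))].

(* With k = 1 these are A_{f_3} and B_{m_1}, with k = n - 1 they are
   A_{f_4} and B_{m_2}. *)
Definition Af (R : realType) (mu : R) (k : nat) : 'M[R]_(k + k) :=
  block_mx 0 mu%:M (- 1%:M) (- 1%:M).

Definition Bm (R : realType) (mu : R) (k : nat) : 'M[R]_(k + k) :=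
  block_mx mu%:M 0 0 1%:M.

Section SystemHmr.
Variables (R : realType) (n : nat) (mu T1 T2 : R).

(* The state (w_1, w_2, tau) is stacked into one column. The input, a vector
   of R^n with n >= 1, is typed with its first component split off. *)
Definition mr_dim : nat := (1 + 1) + (n.-1 + n.-1) + 1.

Definition mr_state (w1 : 'cV[R]_(1 + 1)) (w2 : 'cV[R]_(n.-1 + n.-1))
    (tau : R) : 'cV[R]_mr_dim :=
  col_mx (col_mx w1 w2) tau%:M.

Definition w1_of (chi : 'cV[R]_mr_dim) : 'cV[R]_(1 + 1) :=
  usubmx (usubmx chi).

Definition w2_of (chi : 'cV[R]_mr_dim) : 'cV[R]_(n.-1 + n.-1) :=
  dsubmx (usubmx chi).

Definition tau_of (chi : 'cV[R]_mr_dim) : R := (dsubmx chi) 0 0.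

Definition q1_of (m : 'cV[R]_(1 + n.-1)) : 'cV[R]_(1 + 1) :=
  col_mx (usubmx m) (usubmx m).

Definition q2_of (m : 'cV[R]_(1 + n.-1)) : 'cV[R]_(n.-1 + n.-1) :=
  col_mx (dsubmx m) (dsubmx m).

Definition Hmr : hybrid_system R mr_dim (1 + n.-1) :=
  {| state_space := [set chi | 0 <= tau_of chi <= T2] ;
     flow_set := [set chi | 0 <= tau_of chi <= T2] ;
     flow_map := fun chi m =>
       mr_state (Af mu 1 *m w1_of chi + Bm mu 1 *m q1_of m)
                (Af mu n.-1 *m w2_of chi + Bm mu n.-1 *m q2_of m)
                (- 1) ;
     jump_set := [set chi | tau_of chi = 0] ;
     jump_map := fun chi _ =>
       [set mr_state (w1_of chi) (w2_of chi) tau | tau in `[T1, T2]] |}.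

Definition Ar : set 'cV[R]_mr_dim :=
  [set mr_state 0 0 tau | tau in `[0, T2]].

End SystemHmr.

Arguments Hmr {R} n mu T1 T2.
Arguments Ar {R} n T2.

(* Main.v *)
(* Since Af and Bm are block matrices with scalar blocks, w_1 and w_2 split into
   pairs x' = mu (y + q), y' = - x - y + q, each driven by one input component,
   with x and y unchanged at jumps. For a small multiple 2 eps of the cross
   term, V = x^2 / mu + 2 eps x y + y^2 is an explicit ISS Lyapunov function of
   such a pair, V' <= - c V + d q^2, so exp (c t) (V - (d / c) |m|^2) does not
   increase along hybrid arcs. Likewise - (tau + t - T1 j) does not increase,
   which gives T1 j <= t + T2 and turns decay in t into decay in t + j. *)
Require Import Defs.
From mathcomp Require Import all_boot all_order all_algebra.
From mathcomp Require Import all_classical all_reals all_analysis.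
From mathcomp Require Import ring lra.
Import Order.TTheory GRing.Theory Num.Theory.
Import numFieldNormedType.Exports.
Local Open Scope ring_scope.
Local Open Scope classical_set_scope.

Set Implicit Arguments.
Unset Strict Implicit.
Unset Printing Implicit Defensive.

(** * Induction along a compact real interval *)

(** Consider the supremum of the points of [a, b] satisfying [P]: the local step there starts from a
    nearby point on the left and passes beyond the supremum, unless it has reached [b]. This
    replaces compactness arguments below. *)
Lemma interval_induction (R : realType) (P : R -> Prop) (a b : R) :
  a <= b -> P a ->
  (forall x, a <= x <= b -> exists2 d, 0 < d &
    forall u v, a <= u <= b -> a <= v <= b -> u <= x <= v -> v - u < d ->
      P u -> P v) ->
  P b.
Proof.
move=> ab Pa loc.
pose S := [set x | a <= x <= b /\ P x].
have Sa : S a by rewrite /S /= lexx ab.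
have ubS : ubound S b by move=> x [] /andP[].
have hsS : has_sup S by split; [exists a | exists b].
have aS : a <= sup S by apply: ub_le_sup => //; case: hsS.
have Sb : sup S <= b by apply: ge_sup => //; exists a.
have [|d d0 step] := loc (sup S); first by rewrite aS.
have [u [/andP[au ub] Pu] lu] : exists2 u, S u & sup S - d / 2 < u.
  by apply: sup_adherent => //; lra.
have us : u <= sup S by apply: ub_le_sup; [case: hsS|split; rewrite ?au].
(* Since [u] lies within d/2 of the supremum and d/2 + d/3 < d, the step from [u] to [v] is
   admissible. Then [P v] forces [v = b], as [sup S + d / 3] cannot belong to [S]. *)
pose v := Num.min b (sup S + d / 3).
have vb : v <= b by rewrite ge_min lexx.
have vs : v <= sup S + d / 3 by rewrite ge_min lexx orbT.
have sv : sup S <= v by rewrite le_min Sb /=; lra.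
have Pv : P v by apply: (step u) => //; rewrite ?au ?vb ?us ?sv ?andbT //; lra.
have : v <= sup S.
  apply: ub_le_sup; first by case: hsS.
  by split => //; rewrite vb andbT; lra.
rewrite /v minEle; case: ifP => [bs _|_]; last by lra.
by have -> : b = v by rewrite /v minEle bs.
Qed.

(** * Closure properties of absolutely continuous functions *)

Section AbsContinuous.
Variables (R : realType) (a b : R).
Implicit Types f g h : R -> R.

(** A family of intervals that is short enough for both [f] and [g] is short enough for [h]. Sums,
    products and Lipschitz functions all reduce to this domination. *)
Lemma abs_continuous_dom (f g h : R -> R) (K : R) :
  0 <= K ->
  (forall x y, a <= x -> x <= y -> y <= b ->
    `|h y - h x| <= K * (`|f y - f x| + `|g y - g x|)) ->
  abs_continuous f a b -> abs_continuous g a b -> abs_continuous h a b.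
Proof.
move=> K0 hK acf acg e e0.
(* [K + 1] instead of [K] keeps the denominator positive when [K = 0]. *)
have e'0 : 0 < e / (2 * (K + 1)) by apply: divr_gt0 => //; lra.
have [d1 d10 fd1] := acf _ e'0.
have [d2 d20 gd2] := acg _ e'0.
exists (Num.min d1 d2); first by rewrite lt_min d10.
move=> s sab sp; rewrite lt_min => /andP[s1 s2].
have {}fd1 := fd1 _ sab sp s1; have {}gd2 := gd2 _ sab sp s2.
apply: (@le_lt_trans _ _ (\sum_(p <- s)
    K * (`|f p.2 - f p.1| + `|g p.2 - g p.1|))).
  rewrite big_seq [leRHS]big_seq; apply: ler_sum => p ps.
  by have /allP/(_ _ ps)/and3P[ap pp pb] := sab; exact: hK.
rewrite -big_distrr big_split /=.
set F := \sum_(p <- s) `|f p.2 - f p.1| in fd1 *.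
set G := \sum_(p <- s) `|g p.2 - g p.1| in gd2 *.
have lt1 : F + G < e / (K + 1).
  have -> : e / (K + 1) = e / (2 * (K + 1)) + e / (2 * (K + 1)).
    by field; lra.
  exact: ltrD.
have lt2 : (F + G) * (K + 1) < e by rewrite -ltr_pdivlMr //; lra.
have : 0 <= F + G by rewrite addr_ge0 // sumr_ge0.
nra.
Qed.

Lemma abs_continuous_id : abs_continuous id a b.
Proof.
move=> e e0; exists e => // s sab _; apply: le_lt_trans.
rewrite big_seq [leRHS]big_seq; apply: ler_sum => p ps.
have /allP/(_ _ ps)/and3P[_ pp _] := sab.
by rewrite ger0_norm // subr_ge0.
Qed.

Lemma abs_continuous_lipschitz (h : R -> R) (K : R) : 0 <= K ->
  (forall x y, a <= x -> x <= y -> y <= b -> `|h y - h x| <= K * (y - x)) ->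
  abs_continuous h a b.
Proof.
move=> K0 hK.
apply: (abs_continuous_dom (f := id) (g := id) K0) abs_continuous_id _;
  last exact: abs_continuous_id.
move=> x y ax xy yb; apply: le_trans (hK _ _ ax xy yb) _.
by rewrite ler_wpM2l // ger0_norm ?subr_ge0 // lerDl subr_ge0.
Qed.

Lemma abs_continuous_cst (c : R) : abs_continuous (fun=> c) a b.
Proof.
apply: (abs_continuous_lipschitz (lexx 0)) => x y *.
by rewrite subrr normr0 mul0r.
Qed.

Lemma abs_continuousD (f g : R -> R) : abs_continuous f a b ->
  abs_continuous g a b -> abs_continuous (fun x => f x + g x) a b.
Proof.
apply: (abs_continuous_dom ler01) => x y _ _ _; rewrite mul1r.
by rewrite opprD addrACA ler_normD.
Qed.

Lemma abs_continuous_close (f : R -> R) (e : R) : abs_continuous f a b ->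
  0 < e -> exists2 d, 0 < d & forall x y, a <= x -> x <= y -> y <= b ->
    y - x < d -> `|f y - f x| < e.
Proof.
move=> acf e0; have [d d0 fd] := acf _ e0; exists d => // x y ax xy yb xyd.
by have := fd [:: (x, y)]; rewrite /= !big_seq1 ax xy yb; apply.
Qed.

(** By interval induction on boundedness over [a, z]: a step shorter than the [d] belonging to
    oscillation 1 raises the bound by at most 1. Products need these bounds. *)
Lemma abs_continuous_bounded (f : R -> R) : abs_continuous f a b ->
  exists2 M, 0 <= M & forall x, a <= x <= b -> `|f x| <= M.
Proof.
move=> acf; have [ab|ba] := leP a b; last first.
  by exists 0 => // x /andP[ax xb]; have := le_lt_trans (le_trans ax xb) ba;
    rewrite ltxx.
have [d d0 fd] := abs_continuous_close acf ltr01.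
apply: (@interval_induction R
  (fun z => exists2 M, 0 <= M & forall x, a <= x <= z -> `|f x| <= M) a b ab).
  exists `|f a| => // x; rewrite -eq_le => /eqP <- //.
move=> x _; exists d => // u v /andP[au ub] /andP[av vb] /andP[ux xv] uvd.
case=> M M0 fM; exists (M + 1); first by lra.
move=> y /andP[ay yv]; have [yu|uy] := leP y u.
  by apply: le_trans (fM _ _) _; [rewrite ay|lra].
have : `|f y - f u| < 1 by apply: fd => //; lra.
have : `|f u| <= M by apply: fM; rewrite au /=.
have : `|f y| <= `|f y - f u| + `|f u|
  by have := ler_normD (f y - f u) (f u); rewrite subrK.
lra.
Qed.

Lemma abs_continuousM (f g : R -> R) : abs_continuous f a b ->
  abs_continuous g a b -> abs_continuous (fun x => f x * g x) a b.
Proof.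
move=> acf acg.
have [M M0 fM] := abs_continuous_bounded acf.
have [N N0 gN] := abs_continuous_bounded acg.
apply: (abs_continuous_dom (K := M + N) _ _ acf acg); first by lra.
move=> x y ax xy yb.
have -> : f y * g y - f x * g x = (f y - f x) * g y + f x * (g y - g x).
  by ring.
apply: le_trans (ler_normD _ _) _; rewrite !normrM.
have : `|f x| <= M by apply: fM; lra.
have : `|g y| <= N by apply: gN; lra.
have := normr_ge0 (f x); have := normr_ge0 (g y).
have := normr_ge0 (f y - f x); have := normr_ge0 (g y - g x).
nra.
Qed.

Lemma abs_continuous_expR (c : R) : 0 <= c ->
  abs_continuous (fun t => expR (c * t)) a b.
Proof.
move=> c0; apply: (abs_continuous_lipschitz (K := c * expR (c * b))).
  by rewrite mulr_ge0 ?expR_ge0.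
move=> x y ax xy yb.
have cxy : c * x <= c * y by rewrite ler_wpM2l.
rewrite ger0_norm ?subr_ge0 ?ler_expR //.
have -> : expR (c * y) - expR (c * x) =
    expR (c * y) * (1 - expR (c * x - c * y)).
  by rewrite mulrBr mulr1 -expRD; congr (_ - expR _); ring.
(* The inequality 1 + u <= exp u bounds 1 - exp (c x - c y) by c y - c x, which gives the Lipschitz
   constant without a mean value theorem. *)
have h1 := expR_ge1Dx (c * x - c * y).
apply: (@le_trans _ _ (expR (c * y) * (c * y - c * x))).
  by rewrite ler_wpM2l ?expR_ge0 //; lra.
have -> : c * expR (c * b) * (y - x) = expR (c * b) * (c * y - c * x) by ring.
by rewrite ler_wpM2r ?subr_ge0 // ler_expR ler_wpM2l.
Qed.

End AbsContinuous.

(** * Monotonicity from the sign of the derivative almost everywhere *)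

(** The increment over [u, v] splits at [t] into two one-sided increments, each controlled by a
    difference quotient. Having [t] between [u] and [v] matches the local step of
    [interval_induction]. *)
Lemma is_derive_lt_local (R : realType) (f : R -> R) (t d e : R) :
  is_derive t 1 f d -> d < e -> exists2 r, 0 < r &
    forall u v, u <= t <= v -> v - u < r -> f v - f u <= e * (v - u).
Proof.
move=> [df <-] de.
have ed0 : 0 < e - 'D_1 f t by rewrite subr_gt0.
move/cvgrPdist_lt : df => /(_ _ ed0).
rewrite -/('D_1 f t) near_withinE => /nbhs_ballP[r /= r0 near_t].
have quot h : `|h| < r -> h != 0 -> h^-1 * (f (h + t) - f t) < e.
  move=> hr h0; have := near_t h; rewrite /ball /= sub0r normrN => /(_ hr h0).
  rewrite [_%:A]mulr1 /GRing.scale /= ltr_distlC => /andP[_].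
  lra.
have right v : t <= v -> v - t < r -> f v - f t <= e * (v - t).
  rewrite le_eqVlt => /predU1P[-> _|tv vr]; first by rewrite !subrr mulr0.
  have := quot (v - t); rewrite subrK gtr0_norm ?subr_gt0 // subr_eq0 gt_eqF //.
  by move=> /(_ vr isT); rewrite mulrC ltr_pdivrMr ?subr_gt0 // => /ltW.
have left u : u <= t -> t - u < r -> f t - f u <= e * (t - u).
  rewrite le_eqVlt => /predU1P[-> _|ut ur]; first by rewrite !subrr mulr0.
  have := quot (u - t); rewrite subrK ltr0_norm ?subr_lt0 // opprB subr_eq0.
  rewrite lt_eqF // -(opprB t u) invrN mulNr => /(_ ur isT).
  by rewrite -mulrN (opprB (f u)) mulrC ltr_pdivrMr ?subr_gt0 // => /ltW.
exists r => // u v /andP[ut tv] uvr.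
have := right v tv; have := left u ut.
have -> : f v - f u = (f v - f t) + (f t - f u) by ring.
have -> : e * (v - u) = e * (v - t) + e * (t - u) by ring.
by move=> h1 h2; apply: lerD; [apply: h2; lra|apply: h1; lra].
Qed.

(* Cover the points without a nonpositive derivative by an open set U of small
   measure. By interval induction, f b - f a is at most e (b - a) plus the
   variation of f over finitely many intervals inside U, which absolute
   continuity makes small. *)
Lemma abs_continuous_le (R : realType) (f : R -> R) (a b : R) :
  a <= b -> abs_continuous f a b ->
  {ae (@lebesgue_measure R), forall t : R, a < t < b ->
    exists2 d : R, d <= 0 & is_derive t (1 : R) f d} ->
  f b <= f a.
Proof.
move=> ab acf.
pose N := ~` [set t : R | a < t < b ->
  exists2 d : R, d <= 0 & is_derive t (1 : R) f d].
move=> N0; have {}N0 : (@lebesgue_measure R).-negligible N by [].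
(* In [b - a + 1], the part [b - a] is progress at slope [e], and the 1 pays for a variation of at
   most [e] inside the exceptional set. *)
suff H (e : R) : 0 < e -> f b - f a <= e * (b - a + 1).
  rewrite -subr_le0; apply/ler_addgt0Pr => e e0; rewrite add0r.
  have ba1 : 0 < b - a + 1 by lra.
  have := H (e / (b - a + 1)); rewrite divfK ?gt_eqF //.
  by apply; apply: divr_gt0.
move=> e0; have [r r0 acr] := acf _ e0.
(* The endpoints are added because the derivative is only given on the open interval; every point of
   [a, b] outside the cover then has one. *)
have N'0 : (@lebesgue_measure R).-negligible (N `|` [set a] `|` [set b]).
  apply: negligibleU; first apply: negligibleU => //.
    by exists [set a]; split => //; exact: lebesgue_measure_set1.
  by exists [set b]; split => //; exact: lebesgue_measure_set1.
have /outer_measure_open_le : 0 < r / 2 by lra.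
move=> /(_ (N `|` [set a] `|` [set b])).
rewrite (proj1 (negligible_outer_measure _) N'0) add0e => -[U [oU NU mU]].
have mesU : measurable (U : set (measurableTypeR R)).
  exact: measurable_realfun.open_measurable.
have mes_U x :
    measurable (U `&` `]-oo, x] : set (measurableTypeR R)).
  exact: measurableI.
(* The measure of [U] to the left of [x] serves as a budget of length; it grows by y - x across any
   [x, y] inside [U]. *)
pose m x := fine (lebesgue_measure (U `&` `]-oo, x])).
have mE x : (m x)%:E = lebesgue_measure (U `&` `]-oo, x]).
  rewrite fineK // ge0_fin_numE //; apply: le_lt_trans (ltry (r / 2)).
  by apply: le_trans mU; apply: le_measure; rewrite ?inE.
have m_homo x y : x <= y -> m x <= m y.
  move=> xy; rewrite -lee_fin !mE; apply: le_measure; rewrite ?inE //.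
  by apply: setIS => z /=; rewrite !in_itv /= => /le_trans; apply.
have m_add x y : x <= y -> `[x, y] `<=` U -> m x + (y - x) <= m y.
  move=> xy xyU; rewrite -lee_fin EFinD !mE.
  have <- : lebesgue_measure `]x, y] = (y - x)%:E.
    rewrite lebesgue_measure_itv /= lte_fin.
    move: xy; rewrite le_eqVlt => /predU1P[->|->//].
    by rewrite ltxx subrr.
  rewrite -measureU //; last first.
    rewrite -subset0 => z [[_ /=]]; rewrite !in_itv /= => zx /andP[xz _].
    by move: (lt_le_trans xz zx); rewrite ltxx.
  apply: le_measure; rewrite ?inE //.
    by apply: measurableU.
  move=> z [[Uz]|] /=; rewrite !in_itv /=.
    by move=> zx; split => //=; exact: le_trans xy.
  move=> /andP[xz zy]; split => //.
  by apply: xyU; rewrite /= in_itv /= (ltW xz).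
(* The list [s] collects the steps made inside [U]. Its total length stays within the budget [m x],
   hence below [r] at the end. *)
pose Q x := exists s : seq (R * R),
  [/\ all (fun p => [&& a <= p.1, p.1 <= p.2 & p.2 <= x]) s,
      pairwise (fun p q => (p.2 <= q.1) || (q.2 <= p.1)) s,
      \sum_(p <- s) (p.2 - p.1) <= m x &
      f x - f a <= e * (x - a) + \sum_(p <- s) `|f p.2 - f p.1|].
have : Q b.
  apply: (@interval_induction R Q a b ab).
    exists [::]; split => //; rewrite ?big_nil ?fine_ge0 //.
    by rewrite !subrr mulr0 addr0.
  move=> x xab; have [Ux|nUx] := pselect (U x).
    have [d /= d0 dU] := (nbhs_ballP _ _).1 (open_nbhs_nbhs (conj oU Ux)).
    exists d => // u v /andP[au ub] /andP[av vb] /andP[ux xv] uvd.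
    case=> s [sa sp sm sf]; exists ((u, v) :: s); rewrite /= !big_cons /=.
    have uv := le_trans ux xv.
    split.
    - rewrite au uv lexx /=; apply/allP => p ps.
      have /allP/(_ _ ps)/and3P[-> -> pu] := sa.
      by rewrite (le_trans pu).
    - rewrite sp andbT; apply/allP => p ps.
      by have /allP/(_ _ ps)/and3P[_ _ ->] := sa; rewrite orbT.
    - rewrite addrC; apply: le_trans (m_add _ _ uv _); first by rewrite lerD2r.
      move=> z /=; rewrite in_itv /= => /andP[uz zv]; apply: dU.
      by rewrite /ball /= ltr_distl; lra.
    - have := ler_norm (f v - f u).
      have : e * (u - a) <= e * (v - a) by rewrite ler_wpM2l ?(ltW e0) //; lra.
      move: sf; set S := \sum_(_ <- _) _; lra.
  have [[xa xb] nNx] : (x != a /\ x != b) /\ ~ N x.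
    split; first split.
    - by apply/eqP => xa; apply: nUx; apply: NU; left; right.
    - by apply/eqP => xb; apply: nUx; apply: NU; right.
    - by move=> Nx; apply: nUx; apply: NU; left; left.
  have der : a < x < b -> exists2 d : R, d <= 0 & is_derive x (1 : R) f d.
    exact: contrapT nNx.
  have [|d d0 fd] := der.
    by move: xab; rewrite !lt_neqAle eq_sym xa xb /=.
  (* Outside [U] the derivative is below [e], so the slope term absorbs the step and the list is
     unchanged. *)
  have [d' d'0 loc] := is_derive_lt_local fd (le_lt_trans d0 e0).
  exists d' => // u v /andP[au ub] /andP[av vb] uxv uvd.
  have uv : u <= v by case/andP: uxv => [ux xv]; exact: le_trans xv.
  case=> s [sa sp sm sf]; exists s; split => //.
  - apply/allP => p ps; have /allP/(_ _ ps)/and3P[-> -> pu] := sa.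
    by rewrite (le_trans pu).
  - exact: le_trans (m_homo _ _ uv).
  - have := loc _ _ uxv uvd; move: sf; set S := \sum_(_ <- _) _; lra.
case=> s [sa sp sm sf].
have : \sum_(p <- s) `|f p.2 - f p.1| < e.
  apply: acr => //; apply: le_lt_trans sm _.
  suff : m b <= r / 2 by lra.
  by rewrite -lee_fin mE; apply: le_trans mU; apply: le_measure; rewrite ?inE.
move: sf; set S := \sum_(_ <- _) _; lra.
Qed.

(** * Monotonicity along hybrid arcs *)

Section HybridDomain.
Variables (R : realType) (E : set (R * nat)).
Hypothesis domE : hybrid_time_domain E.

Lemma hybrid_time_domain0 t j : E (t, j) -> E (0, 0%N).
Proof.
case: domE => ge0E /[apply] -[s [s0 smono sE]].
have [] : (E `&` [set p | 0 <= p.1 <= t /\ (p.2 <= j)%N]) (0, 0%N) => //.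
by rewrite sE /=; split => //; rewrite s0 lexx -s0; exact: smono.
Qed.

(** Each flow interval is handled by [abs_continuous_le], each jump by hypothesis, and an induction
    on the number of jumps chains them back to the initial time. *)
Lemma hybrid_nonincreasing (W : R -> nat -> R) :
  (forall j a b, `[a, b] `<=` time_slice E j ->
    abs_continuous (W ^~ j) a b) ->
  (forall j, {ae (@lebesgue_measure R), forall t : R,
    interior (time_slice E j) t ->
    exists2 d : R, d <= 0 & is_derive t (1 : R) (W ^~ j) d}) ->
  (forall t j, E (t, j) -> E (t, j.+1) -> W t j.+1 <= W t j) ->
  forall t j, E (t, j) -> W t j <= W 0 0%N.
Proof.
move=> acW derW jumpW t j Etj.
have [_ /(_ _ _ Etj)[s [s0 smono sE]]] := domE.
have inE' i r : (i <= j)%N -> s i <= r <= s i.+1 -> E (r, i).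
  move=> ij ir; suff : (E `&` [set p | 0 <= p.1 <= t /\ (p.2 <= j)%N]) (r, i).
    by case.
  by rewrite sE.
have flow i r : (i <= j)%N -> s i <= r <= s i.+1 -> W r i <= W (s i) i.
  move=> ij /andP[sir rsi].
  have sub : `[s i, r] `<=` time_slice E i.
    move=> z /=; rewrite in_itv /= => /andP[sz zr].
    by apply: inE' => //; rewrite sz (le_trans zr).
  apply: (@abs_continuous_le R (W ^~ i)) => //; first exact: acW.
  apply: (negligibleS _ (derW i)) => z /=; apply: contra_not => derz sizr.
  apply: derz.
  suff : `]s i, r[ `<=` (time_slice E i)^°.
    by apply; rewrite /= in_itv.
  rewrite -open_subsetE; last exact: itv_open.
  apply: subset_trans sub; exact: subset_itv_oo_cc.
have main i r : (i <= j)%N -> s i <= r <= s i.+1 -> W r i <= W 0 0%N.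
  elim: i r => [|i IH] r ij sir.
    by rewrite -s0; exact: flow.
  apply: le_trans (flow _ _ ij sir) _.
  apply: le_trans (IH (s i.+1) (ltnW ij) _); last first.
    by rewrite lexx andbT; apply: smono; exact: ltnW.
  (* The time [s i.+1] belongs to both slices [i] and [i.+1], which is what makes it a jump time. *)
  apply: jumpW; apply: inE'; rewrite ?lexx ?andbT //; last exact: smono.
    exact: ltnW.
  by apply: smono; exact: ltnW.
have : (E `&` [set p | 0 <= p.1 <= t /\ (p.2 <= j)%N]) (t, j).
  by split => //=; rewrite lexx leqnn (domE.1 _ Etj).
by rewrite sE => -[/= _]; exact: main.
Qed.

End HybridDomain.

(** * Lyapunov estimate for a single pair (x, y) *)

Section Pair.
Variables (R : realType) (mu eps : R).
Hypothesis mu_gt0 : 0 < mu.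
(* Then the cross term of [pairV] is small enough for [pairV] to be positive
   definite, and makes it strictly decreasing along the flow. *)
Hypothesis epsE : 2 * (mu + 1) * eps = 1.

Definition pairV (x y : R) : R := mu^-1 * (x * x) + 2 * eps * (x * y) + y * y.

(** The flow decreases [pairV] at rate eps/2 in x^2 + y^2; dividing by the upper constant of
    [pairV_le] gives [c]. The two terms of [d] are what completing the squares in x and in y costs
    in q^2. *)
Let c : R := eps / (2 * (mu^-1 + 2)).
Let d : R := 2 * (1 + eps) ^+ 2 / eps + 4 * (1 + eps * mu) ^+ 2.

Let eps_gt0 : 0 < eps.
Proof.
have mu1 : 0 < 2 * (mu + 1) by move: mu_gt0; lra.
by rewrite -(pmulr_rgt0 _ mu1) epsE.
Qed.
Let eps_mu_gt0 : 0 < eps * mu. Proof. exact: mulr_gt0. Qed.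
Let eps_le : 2 * eps <= 1. Proof. by move: epsE eps_mu_gt0; lra. Qed.
Let eps_le_mu : 2 * eps <= mu^-1.
Proof. by rewrite -[mu^-1]div1r ler_pdivlMr //; move: epsE eps_gt0; lra. Qed.
Let imu_gt0 : 0 < mu^-1. Proof. by rewrite invr_gt0. Qed.
Let c_gt0 : 0 < c. Proof. by apply: divr_gt0 => //; move: imu_gt0; lra. Qed.
Let d_gt0 : 0 < d.
Proof.
apply: addr_gt0; last first.
  by rewrite mulr_gt0 // exprn_gt0 //; move: eps_mu_gt0; lra.
by rewrite divr_gt0 // mulr_gt0 // exprn_gt0 //; move: eps_gt0; lra.
Qed.

(** The difference is a sum of squares whose coefficients are nonnegative by [eps_le_mu] and
    [eps_le]. *)
Lemma pairV_ge x y : eps * (x ^+ 2 + y ^+ 2) <= pairV x y.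
Proof.
rewrite /pairV -subr_ge0.
have -> : mu^-1 * (x * x) + 2 * eps * (x * y) + y * y - eps * (x ^+ 2 + y ^+ 2)
  = eps * (x + y) ^+ 2 + (mu^-1 - 2 * eps) * x ^+ 2 + (1 - 2 * eps) * y ^+ 2.
  by ring.
by rewrite !addr_ge0 // mulr_ge0 ?sqr_ge0 ?subr_ge0 // ltW.
Qed.

Lemma pairV_le x y : pairV x y <= (mu^-1 + 2) * (x ^+ 2 + y ^+ 2).
Proof.
rewrite /pairV -subr_ge0.
have -> : (mu^-1 + 2) * (x ^+ 2 + y ^+ 2) -
    (mu^-1 * (x * x) + 2 * eps * (x * y) + y * y) =
  eps * (x - y) ^+ 2 + (2 - eps) * x ^+ 2 + (mu^-1 + 1 - eps) * y ^+ 2.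
  by ring.
by rewrite !addr_ge0 // mulr_ge0 ?sqr_ge0 //; move: eps_le imu_gt0 eps_gt0; lra.
Qed.

(** The left side is the derivative of [pairV] along the flow. The xy terms of the two pure squares
    cancel, and the cross term supplies the missing - 2 eps x^2. *)
Lemma pairV_decay x y q :
  mu^-1 * (2 * (x * (mu * (y + q)))) +
  2 * eps * (x * (- x - y + q) + mu * (y + q) * y) + 2 * (y * (- x - y + q))
  <= - c * pairV x y + d * q ^+ 2.
Proof.
have cV : c * pairV x y <= eps / 2 * (x ^+ 2 + y ^+ 2).
  apply: le_trans (ler_wpM2l (ltW c_gt0) (pairV_le x y)) _.
  have K0 : mu^-1 + 2 != 0 by rewrite gt_eqF //; move: imu_gt0; lra.
  by rewrite mulrA /c invfM mulrA divfK.
apply: (@le_trans _ _ (- (eps / 2 * (x ^+ 2 + y ^+ 2)) + d * q ^+ 2));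
  last by rewrite mulNr lerD2r lerN2.
rewrite -subr_ge0.
have -> : - (eps / 2 * (x ^+ 2 + y ^+ 2)) + d * q ^+ 2 -
  (mu^-1 * (2 * (x * (mu * (y + q)))) +
  2 * eps * (x * (- x - y + q) + mu * (y + q) * y) + 2 * (y * (- x - y + q)))
  = eps * (x + y) ^+ 2 + eps / 2 * (x - 2 * (1 + eps) * q / eps) ^+ 2
    + 4^-1 * (y - 4 * (1 + eps * mu) * q) ^+ 2
    (* The factor 2 (mu + 1) eps is left visible so that [epsE] turns this coefficient into 3/4 +
       eps/2 > 0. *)
    + (2 * (mu + 1) * eps * - 1 + 7 / 4 + eps / 2) * y ^+ 2.
  rewrite /d; field; move: eps_gt0 mu_gt0; lra.
rewrite epsE !addr_ge0 // mulr_ge0 ?sqr_ge0 //; move: eps_gt0; lra.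
Qed.

Lemma hybrid_pairV_le (E : set (R * nat)) (x y q : R -> nat -> R) (M : R) :
  hybrid_time_domain E ->
  (forall j a b, `[a, b] `<=` time_slice E j ->
    abs_continuous (x ^~ j) a b /\ abs_continuous (y ^~ j) a b) ->
  (forall j, {ae (@lebesgue_measure R), forall t : R,
    interior (time_slice E j) t ->
    is_derive t (1 : R) (x ^~ j) (mu * (y t j + q t j)) /\
    is_derive t (1 : R) (y ^~ j) (- x t j - y t j + q t j)}) ->
  (forall t j, E (t, j) -> E (t, j.+1) ->
    x t j.+1 = x t j /\ y t j.+1 = y t j) ->
  (forall t j, E (t, j) -> `|q t j| <= M) ->
  forall t j, E (t, j) ->
    pairV (x t j) (y t j) <=
      expR (- (c * t)) * pairV (x 0 0%N) (y 0 0%N) + d / c * M ^+ 2.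
Proof.
move=> domE ac der jump qM t j Etj.
(* The level (d/c) M^2 is where the decay c V balances the largest input term d M^2, so the weighted
   excess over it cannot grow. *)
pose W s i := expR (c * s) * (pairV (x s i) (y s i) + - (d / c * M ^+ 2)).
have : W t j <= W 0 0%N.
  apply: (hybrid_nonincreasing domE) => // {t j Etj}.
  - move=> j a b /ac[acx acy].
    apply: abs_continuousM; first by apply: abs_continuous_expR; rewrite ltW.
    apply: abs_continuousD; last exact: abs_continuous_cst.
    apply: abs_continuousD; last exact: abs_continuousM.
    by apply: abs_continuousD; apply: abs_continuousM;
      (exact: abs_continuous_cst || exact: abs_continuousM).
  - move=> j; apply: (negligibleS _ (der j)) => t /=.
    apply: contra_not => derxy int_t.
    have [dx dy] := derxy int_t.
    exists (expR (c * t) * (c * (pairV (x t j) (y t j) - d / c * M ^+ 2) +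
      (mu^-1 * (2 * (x t j * (mu * (y t j + q t j)))) +
       2 * eps * (x t j * (- x t j - y t j + q t j)
                  + mu * (y t j + q t j) * y t j)
       + 2 * (y t j * (- x t j - y t j + q t j))))).
      rewrite mulr_ge0_le0 ?expR_ge0 //.
      have := pairV_decay (x t j) (y t j) (q t j).
      have : d * q t j ^+ 2 <= d * M ^+ 2.
        rewrite ler_wpM2l ?(ltW d_gt0) // -real_normK ?num_real //.
        have Etj : time_slice E j t := interior_subset int_t.
        have qtM : `|q t j| <= M := qM _ _ Etj.
        by rewrite lerXn2r ?nnegrE // (le_trans _ qtM).
      have -> : c * (pairV (x t j) (y t j) - d / c * M ^+ 2) =
         c * pairV (x t j) (y t j) - d * M ^+ 2 by field; move: c_gt0; lra.
      lra.
    have de := is_derive1_comp (is_derive_expR (c * t))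
      (is_deriveZ c (is_derive_id t (1 : R))).
    have dV := is_deriveD (is_deriveD (is_deriveZ mu^-1 (is_deriveM dx dx))
      (is_deriveZ (2 * eps) (is_deriveM dx dy))) (is_deriveM dy dy).
    have dW := is_deriveM de
      (is_deriveD dV (is_derive_cst (- (d / c * M ^+ 2)) t (1 : R))).
    apply: (is_derive_eq dW).
    rewrite !fctE /= /GRing.scale /=.
    by rewrite /pairV; ring.
  - by move=> t j Etj /(jump _ _ Etj)[xE yE]; rewrite /W xE yE.
rewrite /W mulr0 expR0 mul1r => h.
have e1 : expR (- (c * t)) * expR (c * t) = 1 by rewrite -expRD addNr expR0.
have := ler_wpM2l (expR_ge0 (- (c * t))) h; rewrite mulrA e1 mul1r mulrDr.
have : 0 <= expR (- (c * t)) * (d / c * M ^+ 2).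
  by rewrite mulr_ge0 ?expR_ge0 // mulr_ge0 ?sqr_ge0 // divr_ge0 // ltW.
rewrite mulrN; lra.
Qed.

End Pair.

(** The constants are fixed before the arc and depend on [mu] only, so a single choice serves all
    pairs. The division by [eps] comes from [pairV_ge]. *)
Lemma hybrid_pair_iss (R : realType) (mu : R) : 0 < mu ->
  exists C K c : R, [/\ 0 < C, 0 < K, 0 < c &
  forall (E : set (R * nat)) (x y q : R -> nat -> R) (M : R),
  hybrid_time_domain E ->
  (forall j a b, `[a, b] `<=` time_slice E j ->
    abs_continuous (x ^~ j) a b /\ abs_continuous (y ^~ j) a b) ->
  (forall j, {ae (@lebesgue_measure R), forall t : R,
    interior (time_slice E j) t ->
    is_derive t (1 : R) (x ^~ j) (mu * (y t j + q t j)) /\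
    is_derive t (1 : R) (y ^~ j) (- x t j - y t j + q t j)}) ->
  (forall t j, E (t, j) -> E (t, j.+1) ->
    x t j.+1 = x t j /\ y t j.+1 = y t j) ->
  (forall t j, E (t, j) -> `|q t j| <= M) ->
  forall t j, E (t, j) ->
    x t j ^+ 2 + y t j ^+ 2 <=
      C * expR (- (c * t)) * (x 0 0%N ^+ 2 + y 0 0%N ^+ 2) + K * M ^+ 2].
Proof.
move=> mu_gt0; pose eps := (2 * (mu + 1))^-1.
have eps_gt0 : 0 < eps by rewrite invr_gt0; lra.
have epsE : 2 * (mu + 1) * eps = 1 by rewrite divff // gt_eqF //; lra.
have b_gt0 : 0 < mu^-1 + 2 by rewrite addr_gt0 ?invr_gt0.
pose c := eps / (2 * (mu^-1 + 2)).
pose d := 2 * (1 + eps) ^+ 2 / eps + 4 * (1 + eps * mu) ^+ 2.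
have c_gt0 : 0 < c by rewrite divr_gt0 // mulr_gt0.
have d_gt0 : 0 < d.
  by rewrite !(addr_gt0, divr_gt0, mulr_gt0, exprn_gt0).
exists ((mu^-1 + 2) / eps), (d / c / eps), c.
split; [exact: divr_gt0|by rewrite divr_gt0 ?(divr_gt0 d_gt0)|exact: c_gt0|].
move=> E x y q M domE ac der jump qM t j Etj.
have Vtj := hybrid_pairV_le mu_gt0 epsE domE ac der jump qM Etj.
rewrite -/c -/d in Vtj.
have V0_le := pairV_le mu_gt0 epsE (x 0 0%N) (y 0 0%N).
move: (pairV mu eps (x 0 0%N) (y 0 0%N)) V0_le Vtj => V0 V0_le Vtj.
rewrite -(ler_pM2l eps_gt0); apply: le_trans (pairV_ge mu_gt0 epsE _ _) _.
apply: le_trans Vtj _; rewrite [leRHS]mulrDr lerD //.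
  rewrite !mulrA [eps * _]mulrC mulfK ?gt_eqF // -mulrA mulrCA.
  by rewrite ler_wpM2l ?expR_ge0.
by rewrite [leRHS]mulrA [eps * _]mulrC divfK ?gt_eqF.
Qed.

(** [e] selects k pairs of state coordinates, the x components first, and [g] the input driving each
    pair. An arbitrary system with such coordinates covers both w_1 and w_2; summing over the pairs
    yields the factor [k]. *)
Lemma solution_pair_iss (R : realType) (mu : R) : 0 < mu ->
  exists C K c : R, [/\ 0 < C, 0 < K, 0 < c &
  forall (d p k : nat) (H : hybrid_system R d p)
    (e : 'I_(k + k) -> 'I_d) (g : 'I_k -> 'I_p)
    (E : set (R * nat)) phi m (M : R),
  (forall chi u i, flow_map H chi u (e (lshift k i)) 0 =
    mu * (chi (e (rshift k i)) 0 + u (g i) 0)) ->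
  (forall chi u i, flow_map H chi u (e (rshift k i)) 0 =
    - chi (e (lshift k i)) 0 - chi (e (rshift k i)) 0 + u (g i) 0) ->
  (forall chi u chi' i, jump_map H chi u chi' ->
    chi' (e i) 0 = chi (e i) 0) ->
  solution_pair H E phi m ->
  (forall t j i, E (t, j) -> `|m t j i 0| <= M) ->
  forall t j, E (t, j) ->
    \sum_(i < k + k) phi t j (e i) 0 ^+ 2 <=
      C * expR (- (c * t)) * \sum_(i < k + k) phi 0 0%N (e i) 0 ^+ 2
      + K * k%:R * M ^+ 2].
Proof.
move=> /hybrid_pair_iss[C [K [c [C0 K0 c0 pair]]]].
exists C, K, c; split => // d p k H e g E phi m M flowl flowr jumpH.
move=> [domE _ ac der jump] mM t j Etj.
have pair_i i :
    phi t j (e (lshift k i)) 0 ^+ 2 + phi t j (e (rshift k i)) 0 ^+ 2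
    <= C * expR (- (c * t)) * (phi 0 0%N (e (lshift k i)) 0 ^+ 2
         + phi 0 0%N (e (rshift k i)) 0 ^+ 2) + K * M ^+ 2.
  apply: (pair E (fun s l => phi s l (e (lshift k i)) 0)
    (fun s l => phi s l (e (rshift k i)) 0) (fun s l => m s l (g i) 0)) => //.
  - by move=> l a b ab; split; exact: (ac l a b ab).
  - move=> l; apply: (negligibleS _ (der l).2) => s /=; apply: contra_not.
    move=> ders /ders ders_s; split.
      by rewrite -flowl; exact: ders_s.
    by rewrite -flowr; exact: ders_s.
  - move=> s l Esl Esl'; have [_ /jumpH jE] := jump _ _ Esl Esl'.
    by split; exact: jE.
  - by move=> s l Esl; exact: mM.
rewrite !big_split_ord /= -!big_split /=.
have -> : K * k%:R * M ^+ 2 = \sum_(i < k) K * M ^+ 2.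
  by rewrite sumr_const card_ord -mulr_natr; ring.
by rewrite mulr_sumr -big_split ler_sum.
Qed.

(** * Linear and exponential comparison functions; input norm *)

Section KL.
Variable R : realType.

Lemma class_K_linear (B : R) : 0 < B -> class_K (fun r => B * r).
Proof.
move=> B0; split; last by rewrite mulr0.
- by apply: continuous_subspaceT; exact: mulrl_continuous.
- by move=> x y _ xy; rewrite ltr_pM2l.
Qed.

Lemma class_KL_exp (A a : R) : 0 < A -> 0 < a ->
  class_KL (fun r s => A * expR (- (a * s)) * r).
Proof.
move=> A0 a0; split.
- apply: continuous_subspaceT => -[r s].
  apply: cvgM; last exact: cvg_fst.
  apply: cvgM; first exact: cvg_cst.
  apply: (@continuous_comp _ _ _ (fun p : R * R => - (a * p.2)) expR).
    apply: cvgN; apply: cvgM; [exact: cvg_cst|exact: cvg_snd].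
  exact: continuous_expR.
- move=> s s0; apply: class_K_linear; rewrite mulr_gt0 ?expR_gt0 //.
- move=> r s s' r0 s0 ss'; rewrite ler_wpM2r // ler_wpM2l ?(ltW A0) //.
  by rewrite ler_expR lerN2 ler_wpM2l // ltW.
- move=> r r0; rewrite -[X in _ --> X](mul0r r) -[X in _ --> X * r](mulr0 A).
  apply: cvgMl; apply: cvgMr.
  exact: (cvg_comp _ _ (gt0_cvgMry a0 cvg_id) (@cvgr_expR R)).
Qed.
End KL.

Lemma eucl_coord (R : realType) (k : nat) (x : 'cV[R]_k) (i : 'I_k) :
  `|x i 0| <= eucl x.
Proof.
rewrite -sqrtr_sqr ler_wsqrtr // (bigD1 i) //= lerDl sumr_ge0 // => l _.
exact: sqr_ge0.
Qed.

Lemma input_norm_fin (R : realType) (p : nat) (E : set (R * nat))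
    (m : R -> nat -> 'cV[R]_p) (t : R) (j : nat) :
  E (t, j) -> (input_norm E m < +oo)%E ->
  eucl (m t j) <= fine (input_norm E m).
Proof.
move=> Etj nfin.
have ub : ((eucl (m t j))%:E <= input_norm E m)%E.
  by apply: ereal_sup_ubound; exists (t, j).
(* A point of [E] makes the supremum nonnegative, which excludes the value -oo of an empty domain,
   so [fine] loses nothing. *)
rewrite -lee_fin fineK // ge0_fin_numE //.
by apply: le_trans ub; rewrite lee_fin sqrtr_ge0.
Qed.

(** * Coordinates, distance and timer of [Hmr] *)

Section System.
Variables (R : realType) (n : nat) (mu T1 T2 : R).

Let d := mr_dim n.
Definition w1_index (i : 'I_(1 + 1)) : 'I_d :=
  lshift 1 (lshift (n.-1 + n.-1) i).
Definition w2_index (i : 'I_(n.-1 + n.-1)) : 'I_d :=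
  lshift 1 (rshift (1 + 1) i).
Definition tau_index : 'I_d := rshift ((1 + 1) + (n.-1 + n.-1)) ord0.

Lemma mr_state_w1 a b (c : R) i :
  (mr_state a b c : 'cV[R]_d) (w1_index i) 0 = a i 0.
Proof. by rewrite /mr_state col_mxEu col_mxEu. Qed.

Lemma mr_state_w2 a b (c : R) i :
  (mr_state a b c : 'cV[R]_d) (w2_index i) 0 = b i 0.
Proof. by rewrite /mr_state col_mxEu col_mxEd. Qed.

Lemma mr_state_tau a b (c : R) :
  (mr_state a b c : 'cV[R]_d) tau_index 0 = c.
Proof. by rewrite /mr_state col_mxEd mxE. Qed.

Lemma w1_ofE (chi : 'cV[R]_d) i : w1_of chi i 0 = chi (w1_index i) 0.
Proof. by rewrite !mxE. Qed.

Lemma w2_ofE (chi : 'cV[R]_d) i : w2_of chi i 0 = chi (w2_index i) 0.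
Proof. by rewrite !mxE. Qed.

Lemma tau_ofE (chi : 'cV[R]_d) : tau_of chi = chi tau_index 0.
Proof. by rewrite /tau_of mxE. Qed.

(** All blocks are multiples of the identity, so the flow decouples into k scalar pairs. *)
Lemma Af_Bm_mul k (w : 'cV[R]_(k + k)) (q : 'cV[R]_k) :
  Af mu k *m w + Bm mu k *m col_mx q q =
  col_mx (mu *: (dsubmx w + q)) (- usubmx w - dsubmx w + q).
Proof.
rewrite -{1}[w]vsubmxK !mul_block_col add_col_mx !mul0mx !add0r addr0.
by rewrite !mulNmx !mul1mx !mul_scalar_mx scalerDr.
Qed.

Definition wnorm (chi : 'cV[R]_d) : R :=
  \sum_(i < 1 + 1) chi (w1_index i) 0 ^+ 2 +
  \sum_(i < n.-1 + n.-1) chi (w2_index i) 0 ^+ 2.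

Lemma euclE (chi : 'cV[R]_d) :
  eucl chi = Num.sqrt (wnorm chi + chi tau_index 0 ^+ 2).
Proof.
rewrite /eucl big_split_ord /= big_ord1; congr (Num.sqrt (_ + _)).
exact: big_split_ord.
Qed.

(** The nearest point has the same timer value, which is allowed because it lies in [0, T2]; only
    w_1 and w_2 contribute. *)
Lemma dist_to_Ar (chi : 'cV[R]_d) : 0 <= tau_of chi <= T2 ->
  dist_to (Ar n T2) chi = Num.sqrt (wnorm chi).
Proof.
move=> tau_bnd; rewrite /dist_to.
have euclB t : eucl (chi - mr_state 0 0 t) =
    Num.sqrt (wnorm chi + (tau_of chi - t) ^+ 2).
  rewrite euclE tau_ofE; congr (Num.sqrt (_ + _ + _ ^+ 2)).
  - by apply: eq_bigr => i _; rewrite mxE [X in _ + X]mxE mr_state_w1 mxE subr0.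
  - by apply: eq_bigr => i _; rewrite mxE [X in _ + X]mxE mr_state_w2 mxE subr0.
  - by rewrite mxE [X in _ + X]mxE mr_state_tau.
have lbS : lbound [set eucl (chi - y) | y in Ar n T2] (Num.sqrt (wnorm chi)).
  move=> _ [_ [t _ <-] <-]; rewrite euclB ler_wsqrtr // lerDl sqr_ge0 //.
apply/eqP; rewrite eq_le; apply/andP; split; last first.
  apply: lb_le_inf => //.
  exists (eucl (chi - mr_state 0 0 (tau_of chi))).
  by exists (mr_state 0 0 (tau_of chi)) => //; exists (tau_of chi).
apply: ge_inf; first by exists (Num.sqrt (wnorm chi)).
exists (mr_state 0 0 (tau_of chi)); first by exists (tau_of chi).
by rewrite euclB subrr expr0n /= addr0.
Qed.

(** The timer runs down at unit rate and each jump resets it from 0 to at least [T1], so T1 j is at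
    most t plus the current timer value, itself at most [T2]. *)
Lemma dwell_time (E : set (R * nat)) phi m :
  solution_pair (Hmr n mu T1 T2) E phi m ->
  forall t j, E (t, j) -> T1 * j%:R <= t + T2.
Proof.
case=> [domE state ac der jump] t j Etj.
pose W s i := -1 * phi s i tau_index 0 + (T1 * i%:R - s).
have : W t j <= W 0 0%N.
  apply: (hybrid_nonincreasing domE) => // {t j Etj}.
  - move=> j a b ab; apply: abs_continuousD.
      by apply: abs_continuousM; [exact: abs_continuous_cst|exact: ac ab _].
    apply: (@abs_continuous_lipschitz _ _ _ _ 1) => // x y _ xy _.
    have -> : T1 * j%:R - y - (T1 * j%:R - x) = - (y - x) by ring.
    by rewrite mul1r normrN ger0_norm // subr_ge0.
  - move=> j; apply: (negligibleS _ (der j).2) => t /=; apply: contra_not.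
    move=> ders /ders /(_ tau_index); rewrite mr_state_tau => dtau.
    exists 0 => //.
    have dW := is_deriveD (is_deriveZ (-1) dtau) (is_deriveB
      (is_derive_cst (T1 * j%:R) t (1 : R)) (is_derive_id t (1 : R))).
    apply: (is_derive_eq dW); rewrite /GRing.scale /=; ring.
  - move=> t j Etj Etj'; have [tau0 [t']] := jump _ _ Etj Etj'.
    rewrite /= in_itv /= => /andP[T1t' _] tauE.
    rewrite /W -tauE mr_state_tau -tau_ofE [tau_of _]tau0 -natr1; nra.
have := state _ _ (hybrid_time_domain0 domE Etj).
have := state _ _ Etj; rewrite /= !tau_ofE /W mulr0n; nra.
Qed.

End System.

Arguments w1_index {n}.

(** The pair estimate is used with k = 1 for w_1 and k = n - 1 for w_2, and the two input gains add
    up. *)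
Lemma wnorm_iss (R : realType) (mu : R) (n : nat) : 0 < mu ->
  exists C K c : R, [/\ 0 < C, 0 < K, 0 < c &
  forall T1 T2 E phi m (M : R),
  solution_pair (Hmr n mu T1 T2) E phi m ->
  (forall t j, E (t, j) -> eucl (m t j) <= M) ->
  forall t j, E (t, j) ->
    wnorm (phi t j) <=
      C * expR (- (c * t)) * wnorm (phi 0 0%N) + K * M ^+ 2].
Proof.
move=> /solution_pair_iss[C [K [c [C0 K0 c0 iss]]]].
exists C, (K * (1 + n.-1)%:R), c; split; rewrite ?mulr_gt0 ?ltr0n //.
move=> T1 T2 E phi m M sol mM t j Etj.
have mM' s l i : E (s, l) -> `|m s l i 0| <= M.
  by move=> /mM; exact: le_trans (eucl_coord _ _).
have iss1 := iss _ _ 1%N (Hmr n mu T1 T2) (@w1_index n) (@lshift 1 n.-1)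
  E phi m M _ _ _ sol mM' t j Etj.
have iss2 := iss _ _ n.-1 (Hmr n mu T1 T2) (@w2_index n) (@rshift 1 n.-1)
  E phi m M _ _ _ sol mM' t j Etj.
rewrite /wnorm natrD; set e := expR _ in iss1 iss2 *.
apply: (@le_trans _ _ ((C * e * \sum_(i < 1 + 1) phi 0 0%N (w1_index i) 0 ^+ 2
    + K * 1%:R * M ^+ 2) +
  (C * e * \sum_(i < n.-1 + n.-1) phi 0 0%N (w2_index i) 0 ^+ 2
    + K * n.-1%:R * M ^+ 2))); last first.
  by rewrite le_eqVlt; apply/orP; left; apply/eqP; ring.
apply: lerD; [apply: iss1|apply: iss2].
- move=> chi u i; rewrite /= mr_state_w1 /q1_of Af_Bm_mul col_mxEu.
  by rewrite mxE !mxE.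
- move=> chi u i; rewrite /= mr_state_w1 /q1_of Af_Bm_mul col_mxEd.
  by rewrite !mxE.
- by move=> chi u _ i [tau _ <-]; rewrite mr_state_w1 w1_ofE.
- move=> chi u i; rewrite /= mr_state_w2 /q2_of Af_Bm_mul col_mxEu.
  by rewrite !mxE.
- move=> chi u i; rewrite /= mr_state_w2 /q2_of Af_Bm_mul col_mxEd.
  by rewrite !mxE.
- by move=> chi u _ i [tau _ <-]; rewrite mr_state_w2 w2_ofE.
Qed.

(** * Assembly of the input-to-state bound *)

Unset Implicit Arguments.
Set Strict Implicit.
Local Close Scope classical_set_scope.

Theorem theorem6p3 (R : realType) (n : nat) (T1 T2 mu : R)
    (P2 : 'M[R]_(1 + 1)) (P3 : 'M[R]_(n.-1 + n.-1)) :
  (2 <= n)%N -> 0 < T1 -> T1 <= T2 -> 0 < mu ->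
  posdefmx P2 -> posdefmx P3 ->
  negdefmx (P2 *m Af mu 1 + (Af mu 1)^T *m P2) ->
  negdefmx (P3 *m Af mu n.-1 + (Af mu n.-1)^T *m P3) ->
  input_to_state_stable (Hmr n mu T1 T2) (Ar n T2).
Proof.
move=> _ T1_gt0 _ mu_gt0 _ _ _ _.
have [C [K [c [C0 K0 c0 iss]]]] := wnorm_iss n mu_gt0.
have T1_1 : 0 < 1 + T1 by rewrite addr_gt0.
(* From T1 j <= t + T2 follows T1 (t + j) <= (1 + T1) t + T2, so c t >= a (t + j) - c T2 / (1 + T1).
   The offset goes into [C'], whose factor 2 turns a sum into a maximum. *)
pose a := c * T1 / (1 + T1).
have a0 : 0 < a by rewrite divr_gt0 // mulr_gt0.
pose C' := 2 * C * expR (c * T2 / (1 + T1)).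
have C'0 : 0 < C' by rewrite !mulr_gt0 // expR_gt0.
have K'0 : 0 < 2 * K by rewrite mulr_gt0.
(* [wnorm] is the squared distance, hence the square roots and the halved rate. *)
exists (fun r s => Num.sqrt C' * expR (- (a / 2 * s)) * r),
  (fun r => Num.sqrt (2 * K) * r); split.
- by apply: class_KL_exp; rewrite ?sqrtr_gt0 // divr_gt0.
- by apply: class_K_linear; rewrite sqrtr_gt0.
move=> E phi m sol nfin t j Etj.
set M := fine _.
have [domE state _ _ _] := sol.
rewrite !dist_to_Ar; last exact: state Etj; last first.
  exact: state (hybrid_time_domain0 domE Etj).
have mM s l : E (s, l) -> eucl (m s l) <= M.
  by move=> Esl; exact: input_norm_fin.
have M0 : 0 <= M by apply: le_trans (mM _ _ Etj); rewrite sqrtr_ge0.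
have := iss _ _ _ _ _ _ sol mM _ _ Etj.
set w := wnorm _; set w0 := wnorm _ => ww0.
have w0_ge0 : 0 <= w0 by rewrite addr_ge0 // sumr_ge0 // => i _; exact: sqr_ge0.
set X := _ * _ * Num.sqrt w0; set Y := _ * M.
have X0 : 0 <= X by rewrite !mulr_ge0 ?sqrtr_ge0 ?expR_ge0.
have Y0 : 0 <= Y by rewrite mulr_ge0 ?sqrtr_ge0.
have X2 : X ^+ 2 = C' * expR (- (a * (t + j%:R))) * w0.
  rewrite !exprMn !sqr_sqrtr ?(ltW C'0) // -expRM_natl.
  by congr (_ * expR _ * _); rewrite -mulr_natl; field.
have Y2 : Y ^+ 2 = 2 * K * M ^+ 2 by rewrite exprMn sqr_sqrtr ?(ltW K'0).
have dw := dwell_time sol Etj.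
have expo : - (c * t) <= c * T2 / (1 + T1) + - (a * (t + j%:R)).
  rewrite -(ler_pM2r T1_1) mulrDl mulNr divfK ?gt_eqF // mulNr.
  have -> : a * (t + j%:R) * (1 + T1) = c * (T1 * t + T1 * j%:R).
    by rewrite /a; field; rewrite gt_eqF.
  have := ler_wpM2l (ltW c0) dw; lra.
(* A mean of two squares is at most the larger one, so w is bounded by the square of the maximum of
   X and Y. *)
have wXY : 2 * w <= X ^+ 2 + Y ^+ 2.
  rewrite X2 Y2.
  have : C * expR (- (c * t)) * w0 <=
     C * (expR (c * T2 / (1 + T1)) * expR (- (a * (t + j%:R)))) * w0.
    by rewrite ler_wpM2r // ler_wpM2l ?(ltW C0) // -expRD ler_expR.
  rewrite /C'; lra.
have le_of_sq z : 0 <= z -> w <= z ^+ 2 -> Num.sqrt w <= z.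
  by move=> z0 wz; rewrite -(ger0_norm z0) -sqrtr_sqr ler_wsqrtr.
rewrite le_max; have [XY|YX] := leP X Y; apply/orP; [right|left];
  apply: le_of_sq => //.
  have : X ^+ 2 <= Y ^+ 2 by rewrite lerXn2r.
  lra.
have : Y ^+ 2 <= X ^+ 2 by rewrite lerXn2r // ltW.
lra.
Qed.
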